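(* Let $\mathbb{F}$ be a field of characteristic $2$ and $((\mathfrak{g},[2]),\mathscr{D})$ a ResLieDer pair over $\mathbb{F}$. If $H^2_{\mathrm{ResLD}}(\mathfrak{g};\mathfrak{g})=0$, then $((\mathfrak{g},[2]),\mathscr{D})$ is rigid, i.e. every 1-parameter formal deformation of $((\mathfrak{g},[2]),\mathscr{D})$ is trivial.
   Context: Over a field $\mathbb{F}$ of characteristic $2$: a restricted Lie algebra $(\mathfrak{g},[2])$ is a Lie algebra with a map $x\mapsto x^{[2]}$ such that $[x^{[2]},y]_{\mathfrak{g}}=[x,[x,y]_{\mathfrak{g}}]_{\mathfrak{g}}$, $(ax)^{[2]}=a^2x^{[2]}$, $(x+y)^{[2]}=x^{[2]}+y^{[2]}+[x,y]_{\mathfrak{g}}$. A ResLieDer pair $((\mathfrak{g},[2]),\mathscr{D})$ is a restricted Lie algebra with a linear derivation $\mathscr{D}$ satisfying $\mathscr{D}(x^{[2]})=[x,\mathscr{D}(x)]_{\mathfrak{g}}$. Formal deformation: $\mu_t=\sum_{i\ge0}\mu_it^i$, $\sigma_t=\sum_{i\ge0}\sigma_it^i$, $\mathscr{D}_t=\sum_{i\ge0}\mathscr{D}_it^i$, where $\mu_i:\wedge^2\mathfrak{g}\to\mathfrak{g}$ are alternating bilinear, $\sigma_i:\mathfrak{g}\to\mathfrak{g}$ are maps, $\mathscr{D}_i:\mathfrak{g}\to\mathfrak{g}$ are linear, with $((\mu_0,\sigma_0),\mathscr{D}_0)=(([\cdot,\cdot]_{\mathfrak{g}},[2]),\mathscr{D})$.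 $((\mu_t,\sigma_t),\mathscr{D}_t)$ is a 1-parameter formal deformation of $((\mathfrak{g},[2]),\mathscr{D})$ if it endows the $\mathbb{F}[[t]]$-module $\mathfrak{g}[[t]]$ with a ResLieDer pair structure; here $\mu_t,\mathscr{D}_t$ are extended $\mathbb{F}[[t]]$-(bi)linearly and $\sigma_t$ is extended by $\sigma_t(\sum_i x_it^i)=\sum_i\sigma_t(x_i)t^{2i}+\sum_{i<j}\mu_t(x_i,x_j)t^{i+j}$. Equivalently, for all $x,y,z\in\mathfrak{g}$, $a\in\mathbb{F}$: $\mu_t(x,\mu_t(y,z))+\mu_t(y,\mu_t(z,x))+\mu_t(z,\mu_t(x,y))=0$; $\mu_t(\sigma_t(x),y)+\mu_t(x,\mu_t(x,y))=0$; $\sigma_t(ax)=a^2\sigma_t(x)$; $\sigma_t(x+y)=\sigma_t(x)+\sigma_t(y)+\mu_t(x,y)$; $\mathscr{D}_t(\mu_t(x,y))=\mu_t(\mathscr{D}_t(x),y)+\mu_t(x,\mathscr{D}_t(y))$; $\mathscr{D}_t(\sigma_t(x))=\mu_t(x,\mathscr{D}_t(x))$. Triviality: the deformation $((\mu_t,\sigma_t),\mathscr{D}_t)$ is trivial if there is a formal isomorphism $\pi_t=\sum_{i\ge0}\pi_it^i:\mathfrak{g}[[t]]\to\mathfrak{g}[[t]]$ ($\mathbb{F}[[t]]$-linear), $\pi_i:\mathfrak{g}\to\mathfrak{g}$ linear, $\pi_0=\mathrm{Id}$, such that for all $x,y\in\mathfrak{g}$: $\pi_t(\mu_t(x,y))=[\pi_t(x),\pi_t(y)]_{\mathfrak{g}}$,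 $\pi_t(\sigma_t(x))=(\pi_t(x))^{[2]}$, $\pi_t(\mathscr{D}_t(x))=\mathscr{D}(\pi_t(x))$, where $[\cdot,\cdot]_{\mathfrak{g}}$ and $\mathscr{D}$ are extended $\mathbb{F}[[t]]$-(bi)linearly to $\mathfrak{g}[[t]]$ and $(\sum_i x_it^i)^{[2]}=\sum_i x_i^{[2]}t^{2i}+\sum_{i<j}[x_i,x_j]_{\mathfrak{g}}t^{i+j}$. Cohomology (adjoint coefficients): $C^2_{\mathrm{ResLD}}(\mathfrak{g};\mathfrak{g})$ is the set of $((\varphi_2,\omega_2),\varphi_1)$ with $\varphi_2:\wedge^2\mathfrak{g}\to\mathfrak{g}$ alternating bilinear, $\omega_2:\mathfrak{g}\to\mathfrak{g}$ satisfying $\omega_2(ax)=a^2\omega_2(x)$, $\omega_2(x+y)=\omega_2(x)+\omega_2(y)+\varphi_2(x,y)$, and $\varphi_1:\mathfrak{g}\to\mathfrak{g}$ linear. $Z^2_{\mathrm{ResLD}}(\mathfrak{g};\mathfrak{g})$ is the subspace of those satisfying for all $x,y,z$: (i) the cyclic sum over $(x,y,z)$ of $[x,\varphi_2(y,z)]_{\mathfrak{g}}+\varphi_2([y,z]_{\mathfrak{g}},x)$ is $0$; (ii) $[x,\varphi_2(x,y)]_{\mathfrak{g}}+\varphi_2(x^{[2]},y)+\varphi_2([x,y]_{\mathfrak{g}},x)+[y,\omega_2(x)]_{\mathfrak{g}}=0$; (iii) $\varphi_1([x,y]_{\mathfrak{g}})+[x,\varphi_1(y)]_{\mathfrak{g}}+[y,\varphi_1(x)]_{\mathfrak{g}}+\varphi_2(\mathscr{D}(x),y)+\varphi_2(x,\mathscr{D}(y))+\mathscr{D}(\varphi_2(x,y))=0$;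 (iv) $\varphi_1(x^{[2]})+[x,\varphi_1(x)]_{\mathfrak{g}}+\mathscr{D}(\omega_2(x))+\varphi_2(x,\mathscr{D}(x))=0$. $B^2_{\mathrm{ResLD}}(\mathfrak{g};\mathfrak{g})$ is the set of $\vartheta^1\pi=((d^1\pi,\omega_\pi),\delta\pi)$, $\pi:\mathfrak{g}\to\mathfrak{g}$ linear, where $d^1\pi(x,y)=\pi([x,y]_{\mathfrak{g}})+[x,\pi(y)]_{\mathfrak{g}}+[y,\pi(x)]_{\mathfrak{g}}$, $\omega_\pi(x)=\pi(x^{[2]})+[x,\pi(x)]_{\mathfrak{g}}$, $\delta\pi(x)=\mathscr{D}(\pi(x))+\pi(\mathscr{D}(x))$. $H^2_{\mathrm{ResLD}}=Z^2_{\mathrm{ResLD}}/B^2_{\mathrm{ResLD}}$. *)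

(* Defs.v *)
From HB Require Import structures.
From mathcomp Require Import all_boot all_algebra.
From mathcomp Require Import boolp classical_sets functions.

Set Implicit Arguments.
Unset Strict Implicit.
Unset Printing Implicit Defensive.

Import GRing.Theory.
Local Open Scope ring_scope.
Local Open Scope classical_set_scope.

(* Formal power series with coefficients in V: X stands for the sum of the
   X i t^i. A type synonym of nat -> V, kept distinct because its module
   structure is over the power series ring, not the pointwise one. *)
Definition fps (V : Type) : Type := nat -> V.

HB.instance Definition _ (V : zmodType) := GRing.Zmodule.copy (fps V) (nat -> V).

Lemma fpsP (V : Type) (X Y : fps V) : (forall n, X n = Y n) -> X = Y.
Proof. by move=> XY; apply/funext. Qed.

Lemma fpsDE (V : zmodType) (X Y : fps V) n : (X + Y) n = X n + Y n.
Proof. by []. Qed.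

Definition fpsC (V : zmodType) (c : V) : fps V :=
  fun n => if n is 0%N then c else 0.

Lemma triangle_exchange (V : nmodType) (f : nat -> nat -> nat -> V) n :
  \sum_(i < n.+1) \sum_(j < i.+1) f j (i - j)%N (n - i)%N =
  \sum_(j < n.+1) \sum_(k < (n - j).+1) f j k (n - j - k)%N.
Proof.
transitivity (\sum_(i < n.+1) \sum_(j < n.+1 | (j < i.+1)%N)
    f j (i - j)%N (n - i)%N).
  apply: eq_bigr => -[i /= ltin] _.
  exact: (big_ord_widen n.+1 (fun j => f j (i - j)%N (n - i)%N)).
rewrite (exchange_big_dep xpredT) //=.
apply: eq_bigr => -[j /= ltjn] _.
rewrite -(big_mkord xpredT (fun k => f j k (n - j - k)%N)).
rewrite -(big_mkord (fun i => j <= i)%N (fun i => f j (i - j)%N (n - i)%N)).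
transitivity (\sum_(j <= i < n.+1) f j (i - j)%N (n - i)%N).
  by rewrite [RHS](big_nat_widenl j 0).
rewrite -{1}[j]add0n big_addn subSn //.
by apply: eq_bigr => k _; rewrite addnK addnC subnDA.
Qed.

Section FpsRing.
Variable R : comNzRingType.
Implicit Types a b c : fps R.

Definition fps_mul a b : fps R :=
  fun n => \sum_(i < n.+1) a i * b (n - i)%N.

Lemma fps_mulA : associative fps_mul.
Proof.
move=> a b c; apply: fpsP => n; rewrite /fps_mul.
under [RHS]eq_bigr do rewrite mulr_suml.
rewrite (triangle_exchange (fun i j k => a i * b j * c k)).
apply: eq_bigr => i _; rewrite mulr_sumr.
by apply: eq_bigr => j _; rewrite mulrA.
Qed.

Lemma fps_mulC : commutative fps_mul.
Proof.
move=> a b; apply: fpsP => n; rewrite /fps_mul (reindex_inj rev_ord_inj) /=.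
apply: eq_bigr => -[i /= ltin] _.
by rewrite subSS subKn // mulrC.
Qed.

Lemma fps_mul1 : left_id (fpsC 1) fps_mul.
Proof.
move=> a; apply: fpsP => n; rewrite /fps_mul big_ord_recl /= subn0 mul1r.
by rewrite big1 ?addr0 // => i _; rewrite mul0r.
Qed.

Lemma fps_mulDl : left_distributive fps_mul +%R.
Proof.
move=> a b c; apply: fpsP => n; rewrite fpsDE /fps_mul -big_split /=.
by apply: eq_bigr => i _; rewrite -mulrDl.
Qed.

Lemma fps_one_neq0 : fpsC 1 != 0 :> fps R.
Proof. by apply/eqP => /(congr1 (@^~ 0%N)) /eqP; rewrite oner_eq0. Qed.

HB.instance Definition _ := GRing.Zmodule_isComNzRing.Build (fps R)
  fps_mulA fps_mulC fps_mul1 fps_mulDl fps_one_neq0.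

Variable V : lmodType R.
Implicit Types X Y : fps V.

Definition fps_scale (a : fps R) X : fps V :=
  fun n => \sum_(i < n.+1) a i *: X (n - i)%N.

Lemma fps_scaleA a b X : fps_scale a (fps_scale b X) = fps_scale (a * b) X.
Proof.
apply: fpsP => n; rewrite /fps_scale.
under [RHS]eq_bigr do rewrite [(a * b) _]/(fps_mul a b _) scaler_suml.
rewrite (triangle_exchange (fun i j k => (a i * b j) *: X k)).
apply: eq_bigr => i _; rewrite scaler_sumr.
by apply: eq_bigr => j _; rewrite scalerA.
Qed.

Lemma fps_scale1 : left_id 1 fps_scale.
Proof.
move=> X; apply: fpsP => n; rewrite /fps_scale big_ord_recl /= subn0 scale1r.
by rewrite big1 ?addr0 // => i _; rewrite scale0r.
Qed.

Lemma fps_scaleDr : right_distributive fps_scale +%R.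
Proof.
move=> a X Y; apply: fpsP => n.
rewrite fpsDE /fps_scale -big_split /=.
by apply: eq_bigr => i _; rewrite -scalerDr.
Qed.

Lemma fps_scaleDl X : {morph fps_scale^~ X : a b / a + b}.
Proof.
move=> a b; apply: fpsP => n.
rewrite fpsDE /fps_scale -big_split /=.
by apply: eq_bigr => i _; rewrite -scalerDl.
Qed.

HB.instance Definition _ := GRing.Zmodule_isLmodule.Build (fps R) (fps V)
  fps_scaleA fps_scale1 fps_scaleDr fps_scaleDl.

End FpsRing.

(* ResLieDer pairs are defined over a commutative ring so that the same
   definition applies to g over F and to g[[t]] over F[[t]]; the base ring is
   meant to have characteristic 2, whence the signs. *)
Section ResLieDer.
Variables (R : comNzRingType) (L : lmodType R).

Definition alternating_bilinear (br : L -> L -> L) : Prop :=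
  bilinear_for *:%R *:%R br /\ forall x, br x x = 0.

Record lie_bracket (br : L -> L -> L) : Prop := LieBracket {
  lie_alternating : alternating_bilinear br;
  lie_jacobi : forall x y z, br x (br y z) + br y (br z x) + br z (br x y) = 0
}.

Record restricted_lie (br : L -> L -> L) (sq : L -> L) : Prop := RestrictedLie {
  restricted_lie_bracket : lie_bracket br;
  restricted_ad : forall x y, br (sq x) y = br x (br x y);
  restricted_scale : forall a x, sq (a *: x) = a ^+ 2 *: sq x;
  restricted_add : forall x y, sq (x + y) = sq x + sq y + br x y
}.

Record reslieder (br : L -> L -> L) (sq D : L -> L) : Prop := ResLieDer {
  reslieder_restricted : restricted_lie br sq;
  reslieder_linear : linear D;
  reslieder_der : forall x y, D (br x y) = br (D x) y + br x (D y);
  reslieder_sq : forall x, D (sq x) = br x (D x)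
}.

End ResLieDer.

(* Coefficientwise form of the F[[t]]-(bi)linear extensions of the series of maps
   p and m, and of
     X |-> \sum_i s_t(X_i) t^(2i) + \sum_(i<j) m_t(X_i, X_j) t^(i+j). *)
Section Extensions.
Variable V : zmodType.

Definition lin_ext (p : fps (V -> V)) (X : fps V) : fps V :=
  fun n => \sum_(i < n.+1) \sum_(k < n.+1 | (i + k == n)%N) p k (X i).

Definition bilin_ext (m : fps (V -> V -> V)) (X Y : fps V) : fps V :=
  fun n => \sum_(i < n.+1) \sum_(j < n.+1) \sum_(k < n.+1 | (i + j + k == n)%N)
    m k (X i) (Y j).

Definition sq_ext (m : fps (V -> V -> V)) (s : fps (V -> V)) (X : fps V) :
    fps V :=
  fun n => \sum_(i < n.+1) \sum_(k < n.+1 | (i.*2 + k == n)%N) s k (X i)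
    + \sum_(i < n.+1) \sum_(j < n.+1 | (i < j)%N)
        \sum_(k < n.+1 | (i + j + k == n)%N) m k (X i) (X j).

End Extensions.

Section Deformations.
Variables (F : fieldType) (g : lmodType F).
Variables (br : g -> g -> g) (sq D : g -> g).

Record formal_deformation (mu : fps (g -> g -> g)) (sigma Dt : fps (g -> g)) :
    Prop := FormalDeformation {
  deformation_mu : forall i, alternating_bilinear (mu i);
  deformation_D : forall i, linear (Dt i);
  deformation_mu0 : mu 0%N = br;
  deformation_sigma0 : sigma 0%N = sq;
  deformation_D0 : Dt 0%N = D;
  deformation_reslieder :
    @reslieder (fps F) (fps g) (bilin_ext mu) (sq_ext mu sigma) (lin_ext Dt)
}.

Definition formal_isomorphism (p : fps (g -> g)) : Prop :=
  [/\ forall i, linear (p i), p 0%N = id & bijective (lin_ext p)].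

Definition trivial_deformation (mu : fps (g -> g -> g))
    (sigma Dt : fps (g -> g)) : Prop :=
  exists2 p : fps (g -> g), formal_isomorphism p &
    [/\ forall x y : g, lin_ext p (fun k => mu k x y) =
          bilin_ext (fpsC br) (fun i => p i x) (fun i => p i y),
        forall x : g, lin_ext p (fun k => sigma k x) =
          sq_ext (fpsC br) (fpsC sq) (fun i => p i x)
      & forall x : g, lin_ext p (fun k => Dt k x) =
          lin_ext (fpsC D) (fun i => p i x)].

Definition rigid : Prop :=
  forall (mu : fps (g -> g -> g)) (sigma Dt : fps (g -> g)),
    formal_deformation mu sigma Dt -> trivial_deformation mu sigma Dt.

End Deformations.

Section Cohomology.
Variables (F : fieldType) (g : lmodType F).
Variables (br : g -> g -> g) (sq D : g -> g).

(* candidates ((phi2, omega2), phi1), with pointwise addition *)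
Definition triple : zmodType := ((g -> g -> g) * (g -> g) * (g -> g))%type.

Definition C2 : set triple := [set c |
  let: (phi2, omega2, phi1) := c in
  [/\ alternating_bilinear phi2,
      forall a x, omega2 (a *: x) = a ^+ 2 *: omega2 x,
      forall x y, omega2 (x + y) = omega2 x + omega2 y + phi2 x y
    & linear phi1]].

Definition Z2 : set triple := [set c | C2 c /\
  let: (phi2, omega2, phi1) := c in
  [/\ forall x y z,
        (br x (phi2 y z) + phi2 (br y z) x)
        + (br y (phi2 z x) + phi2 (br z x) y)
        + (br z (phi2 x y) + phi2 (br x y) z) = 0,
      forall x y,
        br x (phi2 x y) + phi2 (sq x) y + phi2 (br x y) x + br y (omega2 x) = 0,
      forall x y,
        phi1 (br x y) + br x (phi1 y) + br y (phi1 x)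
        + phi2 (D x) y + phi2 x (D y) + D (phi2 x y) = 0
    & forall x,
        phi1 (sq x) + br x (phi1 x) + D (omega2 x) + phi2 x (D x) = 0]].

Definition theta1 (p : g -> g) : triple :=
  ((fun x y => p (br x y) + br x (p y) + br y (p x),
    fun x => p (sq x) + br x (p x)),
   fun x => D (p x) + p (D x)).

Definition B2 : set triple := [set theta1 p | p in [set p : g -> g | linear p]].

(* the quotient Z2 / B2, as the set of cosets of B2 by elements of Z2; its zero
   element is B2 itself *)
Definition H2 : set (set triple) := [set [set c + b | b in B2] | c in Z2].

Definition H2_eq0 : Prop := H2 = [set B2].

End Cohomology.

(* Main.v *)
Require Import Defs.
From mathcomp Require Import all_boot all_algebra.
From mathcomp Require Import boolp functions zify.

Set Implicit Arguments.
Unset Strict Implicit.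
Unset Printing Implicit Defensive.

Import GRing.Theory.
Local Open Scope ring_scope.

(** A formal isomorphism p = id + p_1 t + p_2 t^2 + ... from a deformation to
    the undeformed pair is built one coefficient at a time. Suppose that p
    satisfies the three morphism equations modulo t^N, with N > 0, and measure
    its failure by the defects

      E(X, Y) = p(mu_t(X, Y)) + [p X, p Y],   W(X) = p(sigma_t X) + (p X)^[2],
      P(X) = p(D_t X) + D(p X)

    (signs are irrelevant in characteristic 2). Applying p to an axiom of the
    deformed pair and subtracting the same axiom of the undeformed pair, read on
    g[[t]] at p X, p Y, ..., gives an identity between defects, for instance

      sum over cyclic permutations of [p X, E(Y, Z)] + E(X, mu_t(Y, Z)) = 0.

    Since E is F[[t]]-bilinear, P is F[[t]]-linear and both are divisible by t^N,
    the coefficient of t^N in E(X, Y) and P(X) depends on X and Y only through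
    their constant terms.
    The coefficients of t^N in these identities are therefore exactly the
    cocycle conditions for the coefficients (E_N, W_N, P_N) of the defects
    ([obstruction_cocycle]); neither the inverse of p nor the transported
    structure is needed. As the second cohomology vanishes, this cocycle is
    theta1 rho for some linear rho, and p + rho t^N satisfies the morphism
    equations modulo t^(N+1) ([morphism_mod_step]). The coefficients stabilize
    ([successive_approximation]), and a series with p_0 = id is bijective
    ([lin_ext_bijective]).

    The argument uses the axioms of the given pair on g[[t]]. Those of
    [bracketxx], [jacobix], [adx_sq] and [Dx_sq] follow from [additive_eq0]: an
    additive map that multiplies by a positive power of t when its argument is
    multiplied by t vanishes if it vanishes on constant series. Where X occurs
    quadratically, the sum of both sides is additive in X because its
    polarization vanishes: by the symmetry of the bracket, by the Jacobi identity
    and by the derivation rule, respectively. *)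

(** * Power series and the t-adic filtration *)

(** [fps_small N X] says that X is divisible by t^N. *)
Definition fps_small (V : zmodType) (N : nat) (X : fps V) : Prop :=
  forall m, (m < N)%N -> X m = 0.

(** The indeterminate t. *)
Definition fpsT (R : comNzRingType) : fps R := fun n => (n == 1%N)%:R.

Section PowerSeries.
Variables (R : comNzRingType) (V : lmodType R).
Implicit Types (X Y : fps V) (a : fps R).

Lemma fps_scaleE a X n : (a *: X) n = \sum_(i < n.+1) a i *: X (n - i)%N.
Proof. by []. Qed.

Lemma fpsC_scaleE (c : R) X n : (fpsC c *: X) n = c *: X n.
Proof.
rewrite fps_scaleE big_ord_recl subn0 big1 ?addr0 // => i _.
by rewrite scale0r.
Qed.

Lemma fpsT_scale0 X : (fpsT R *: X) 0%N = 0.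
Proof. by rewrite fps_scaleE big_ord1 scale0r. Qed.

Lemma fpsT_scaleS X n : (fpsT R *: X) n.+1 = X n.
Proof.
rewrite fps_scaleE 2!big_ord_recl !lift0 scale0r add0r scale1r subSS subn0.
by rewrite big1 ?addr0 // => i _; rewrite scale0r.
Qed.

Lemma fpsC0 : fpsC 0 = 0 :> fps V.
Proof. by apply: fpsP => -[]. Qed.

Lemma fpsCD (x y : V) : fpsC (x + y) = fpsC x + fpsC y :> fps V.
Proof. by apply: fpsP => -[|n]; rewrite fpsDE ?addr0. Qed.

Lemma fpsCZ (c : R) (x : V) : fpsC (c *: x) = fpsC c *: fpsC x.
Proof. by apply: fpsP => -[|n]; rewrite fpsC_scaleE ?scaler0. Qed.

Lemma fps_split X : X = fpsC (X 0%N) + fpsT R *: ((fun n => X n.+1) : fps V).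
Proof.
apply: fpsP => -[|n]; rewrite fpsDE ?fpsT_scale0 ?addr0 //.
by rewrite fpsT_scaleS add0r.
Qed.

Lemma fps_smallD N X Y : fps_small N X -> fps_small N Y -> fps_small N (X + Y).
Proof. by move=> sX sY m ltmN; rewrite fpsDE sX // sY // addr0. Qed.

Lemma fps_smallZ N a X : fps_small N X -> fps_small N (a *: X).
Proof.
move=> sX m ltmN; rewrite fps_scaleE big1 // => i _.
by rewrite sX ?scaler0 //; apply: leq_ltn_trans ltmN; apply: leq_subr.
Qed.

Lemma fps_smallT N X : fps_small N X -> fps_small N.+1 (fpsT R *: X).
Proof.
by move=> sX [|m] ltmN; rewrite ?fpsT_scale0 // fpsT_scaleS; apply: sX.
Qed.

Lemma fps_smallS N M X : (M <= N)%N -> fps_small N X -> fps_small M X.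
Proof. by move=> leMN sX m ltmM; apply/sX/(leq_trans ltmM). Qed.

Lemma fps_small_eq0 X : (forall N, fps_small N X) -> X = 0.
Proof. by move=> sX; apply: fpsP => n; apply: (sX n.+1). Qed.

End PowerSeries.

Lemma fpsC_sqr (R : comNzRingType) (c : R) :
  fpsC c ^+ 2 = fpsC (c ^+ 2) :> fps R.
Proof.
apply: fpsP => n; rewrite expr2 [LHS](fpsC_scaleE c (fpsC c : fps R^o)).
by case: n => [|n] //=; rewrite scaler0.
Qed.

Section AdditiveSeries.
Variables (R : comNzRingType) (V W : lmodType R) (f : fps V -> fps W) (e : nat).
Hypotheses (fD : forall X Y, f (X + Y) = f X + f Y)
  (fT : forall X, f (fpsT R *: X) = fpsT R ^+ e.+1 *: f X).

(** An additive map that scales t by a positive power of t is governed by its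
    values on constant series: X and its constant term differ by a multiple
    of t. *)
Lemma additive_small N : (forall x, fps_small N (f (fpsC x))) ->
  forall X, fps_small N (f X).
Proof.
move=> fN; suff: forall M, (M <= N)%N -> forall X, fps_small M (f X) by exact.
elim=> [_ X m //|M IH ltMN X].
rewrite (fps_split X) fD fT; apply: fps_smallD.
  exact: fps_smallS (fN _).
by rewrite exprS -scalerA; apply/fps_smallT/fps_smallZ/IH/ltnW.
Qed.

(** If the values on constant series are divisible by t^N, the coefficient of
    t^N of f X depends on the constant term of X only. *)
Lemma additive_lead N : (forall x, fps_small N (f (fpsC x))) ->
  forall X, f X N = f (fpsC (X 0%N)) N.
Proof.
move=> fN X; rewrite {1}(fps_split X) fD fT fpsDE exprS -scalerA.
rewrite (@fps_smallT _ _ N) ?addr0 //.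
exact/fps_smallZ/additive_small.
Qed.

Lemma additive_eq0 : (forall x, f (fpsC x) = 0) -> forall X, f X = 0.
Proof.
move=> f0 X; apply: fps_small_eq0 => N; apply: additive_small => x.
by rewrite f0 => m.
Qed.

End AdditiveSeries.

Section Linear.
Variables (R : comNzRingType) (V W : lmodType R) (f : V -> W).
Hypothesis lf : linear f.

Lemma lin_add x y : f (x + y) = f x + f y.
Proof. by have := lf 1 x y; rewrite !scale1r. Qed.

Lemma lin_0 : f 0 = 0.
Proof. by have := lf (-1) 0 0; rewrite scaler0 addr0 scaleN1r addNr. Qed.

Lemma lin_scale a x : f (a *: x) = a *: f x.
Proof. by have := lf a x 0; rewrite lin_0 !addr0. Qed.

Lemma lin_sum (I : Type) (r : seq I) (P : pred I) (F : I -> V) :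
  f (\sum_(i <- r | P i) F i) = \sum_(i <- r | P i) f (F i).
Proof. exact: (big_morph f lin_add lin_0). Qed.

End Linear.

Lemma linear_addZ (R : comNzRingType) (V W : lmodType R) (f : V -> W) :
  (forall x y, f (x + y) = f x + f y) -> (forall a x, f (a *: x) = a *: f x) ->
  linear f.
Proof. by move=> fD fZ a x y; rewrite fD fZ. Qed.

Section LinearSeries.
Variables (R : comNzRingType) (V W : lmodType R).

Lemma linear_lead (f : fps V -> fps W) N : linear f ->
  (forall x, fps_small N (f (fpsC x))) ->
  forall X, f X N = f (fpsC (X 0%N)) N.
Proof.
move=> lf; apply: (@additive_lead _ _ _ f 0); first exact: lin_add.
by move=> X; rewrite lin_scale // expr1.
Qed.

Lemma bilinear_lead (B : fps V -> fps V -> fps W) N :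
  (forall Y, linear (B^~ Y)) -> (forall X, linear (B X)) ->
  (forall x y, fps_small N (B (fpsC x) (fpsC y))) ->
  forall X Y, B X Y N = B (fpsC (X 0%N)) (fpsC (Y 0%N)) N.
Proof.
move=> lB1 lB2 BN X Y.
have BN1 x : fps_small N (B (fpsC x) Y).
  apply: (@additive_small _ _ _ (B (fpsC x)) 0) => //; first exact: lin_add.
  by move=> Z; rewrite lin_scale // expr1.
by rewrite (linear_lead (lB1 Y) BN1) (linear_lead (lB2 _)).
Qed.

End LinearSeries.

(** * The extensions of coefficient maps to power series *)

Section Coefficients.
Variable V : zmodType.
Implicit Types (X Y : fps V) (n : nat).

Lemma sum_addn_eq i n (h : nat -> V) :
  \sum_(k < n.+1 | (i + k == n)%N) h k = if (i <= n)%N then h (n - i)%N else 0.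
Proof.
case: leqP => [lein|ltni]; last first.
  rewrite big_pred0 // => k; apply/negbTE.
  by rewrite neq_ltn (leq_trans ltni (leq_addr _ _)) orbT.
rewrite (big_pred1 (inord (n - i)%N)) ?inordK ?ltnS ?leq_subr // => k /=.
rewrite -(inj_eq val_inj) /= inordK ?ltnS ?leq_subr //.
by rewrite -[RHS](eqn_add2l i) subnKC.
Qed.

Lemma sum_fpsC_eq (T : Type) (phi : T -> V) (f : fps T) i n :
  (forall k, phi (f k.+1) = 0) ->
  \sum_(k < n.+1 | (i + k == n)%N) phi (f k) =
  if i == n then phi (f 0%N) else 0.
Proof.
move=> f0; rewrite (sum_addn_eq i n (fun k => phi (f k))).
case: (ltngtP i n) => [ltin||->] //.
  by rewrite -[(n - i)%N]prednK ?subn_gt0 // f0.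
by rewrite subnn.
Qed.

Lemma lin_extE (p : fps (V -> V)) X n :
  lin_ext p X n = \sum_(i < n.+1) p (n - i)%N (X i).
Proof.
by apply: eq_bigr => i _; rewrite (sum_addn_eq i n (p^~ (X i))) -ltnS ltn_ord.
Qed.

Lemma lin_ext_fpsC (p : V -> V) X n : lin_ext (fpsC p) X n = p (X n).
Proof.
rewrite lin_extE big_ord_recr /= subnn big1 ?add0r // => i _.
by rewrite -[(n - i)%N]prednK // subn_gt0.
Qed.

Lemma bilin_extE (m : fps (V -> V -> V)) X Y n :
  bilin_ext m X Y n =
  \sum_(i < n.+1) lin_ext (fun k => m k (X i)) Y (n - i)%N.
Proof.
apply: eq_bigr => i _; rewrite lin_extE.
under eq_bigr do rewrite (sum_addn_eq _ n (fun k => m k (X i) _)).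
rewrite -big_mkcond /=.
have lt_n : (n - i < n.+1)%N by rewrite ltnS leq_subr.
rewrite (big_ord_widen n.+1 (fun j => m (n - i - j)%N (X i) (Y j))) //.
apply: eq_big => [j|j _]; last by rewrite subnDA.
by rewrite ltnS leq_subRL // -ltnS.
Qed.

Lemma bilin_ext_flip (m : fps (V -> V -> V)) X Y :
  bilin_ext m X Y = bilin_ext (fun k x y => m k y x) Y X.
Proof.
apply: fpsP => n; rewrite [LHS]exchange_big; apply: eq_bigr => i _.
by apply: eq_bigr => j _; apply: eq_bigl => k; rewrite (addnC i).
Qed.

Lemma bilin_ext_fpsC (b : V -> V -> V) X Y n :
  bilin_ext (fpsC b) X Y n = \sum_(i < n.+1) b (X i) (Y (n - i)%N).
Proof.
rewrite bilin_extE; apply: eq_bigr => i _; rewrite -lin_ext_fpsC.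
by congr (lin_ext _ _ _); apply: fpsP => -[].
Qed.

Lemma bilin_ext_fpsC_sum (b : V -> V -> V) X Y n :
  bilin_ext (fpsC b) X Y n =
  \sum_(i < n.+1) \sum_(j < n.+1 | (i + j == n)%N) b (X i) (Y j).
Proof.
rewrite bilin_ext_fpsC; apply: eq_bigr => i _.
by rewrite (sum_addn_eq i n (fun j => b (X i) (Y j))) -ltnS ltn_ord.
Qed.

Lemma sq_ext_fpsC (b : V -> V -> V) (q : V -> V) X n :
  sq_ext (fpsC b) (fpsC q) X n =
  \sum_(i < n.+1 | (i.*2 == n)%N) q (X i) +
  \sum_(i < n.+1) \sum_(j < n.+1 | (i < j)%N && (i + j == n)%N) b (X i) (X j).
Proof.
congr (_ + _).
  rewrite [RHS]big_mkcond; apply: eq_bigr => i _.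
  exact: (@sum_fpsC_eq _ (fun h : V -> V => h (X i)) (fpsC q) i.*2).
apply: eq_bigr => i _; rewrite [RHS]big_mkcondr; apply: eq_bigr => j _.
exact: (@sum_fpsC_eq _ (fun h : V -> V -> V => h (X i) (X j)) (fpsC b)
  (i + j)%N).
Qed.

(** Only the coefficients up to n matter for the coefficient n. *)
Lemma lin_ext_local (p q : fps (V -> V)) X Y n :
  (forall i, (i <= n)%N -> p i = q i) -> (forall i, (i <= n)%N -> X i = Y i) ->
  lin_ext p X n = lin_ext q Y n.
Proof.
move=> pq XY; rewrite !lin_extE; apply: eq_bigr => i _.
by rewrite pq ?leq_subr // XY // -ltnS.
Qed.

Lemma bilin_ext_local (m : fps (V -> V -> V)) X X' Y Y' n :
  (forall i, (i <= n)%N -> X i = X' i) -> (forall i, (i <= n)%N -> Y i = Y' i) ->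
  bilin_ext m X Y n = bilin_ext m X' Y' n.
Proof.
move=> XX' YY'; apply: eq_bigr => i _; apply: eq_bigr => j _.
by apply: eq_bigr => k _; rewrite XX' ?YY' // -ltnS.
Qed.

Lemma sq_ext_local (m : fps (V -> V -> V)) (s : fps (V -> V)) X Y n :
  (forall i, (i <= n)%N -> X i = Y i) -> sq_ext m s X n = sq_ext m s Y n.
Proof.
move=> XY; congr (_ + _); apply: eq_bigr => i _.
  by apply: eq_bigr => k _; rewrite XY // -ltnS.
apply: eq_bigr => j _; apply: eq_bigr => k _.
by rewrite !XY // -ltnS.
Qed.

Lemma lin_ext_C (p : fps (V -> V)) x : (forall i, p i 0 = 0) ->
  lin_ext p (fpsC x) = fun k => p k x.
Proof.
move=> p0; apply: fpsP => n; rewrite lin_extE big_ord_recl subn0 /=.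
by rewrite big1 ?addr0.
Qed.

Lemma bilin_ext_C (m : fps (V -> V -> V)) x y :
  (forall k u, m k u 0 = 0) -> (forall k u, m k 0 u = 0) ->
  bilin_ext m (fpsC x) (fpsC y) = fun k => m k x y.
Proof.
move=> mr0 ml0; apply: fpsP => n; rewrite bilin_extE big_ord_recl subn0 /=.
rewrite big1 => [|i _]; first by rewrite addr0 (@lin_ext_C (fun k => m k x)).
by rewrite lin_extE big1.
Qed.

Lemma sq_ext_C (m : fps (V -> V -> V)) (s : fps (V -> V)) x :
  (forall k u, m k u 0 = 0) -> (forall k, s k 0 = 0) ->
  sq_ext m s (fpsC x) = fun k => s k x.
Proof.
move=> m0 s0; apply: fpsP => n; rewrite /sq_ext [X in _ + X]big1 => [|i _].
  rewrite addr0 big_ord_recl [X in _ + X]big1 => [|i _]; last by rewrite big1.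
  by rewrite (sum_addn_eq 0 n (s^~ x)) subn0 /= addr0.
rewrite big1 // => -[[|j] ltj] //= _.
by rewrite big1.
Qed.

End Coefficients.

Section LinearExtensions.
Variables (R : comNzRingType) (V : lmodType R).
Implicit Types (X Y : fps V).

Lemma lin_ext_linear (p : fps (V -> V)) : (forall i, linear (p i)) ->
  linear (lin_ext p : fps V -> fps V).
Proof.
move=> lp; apply: linear_addZ => [X Y|a X]; apply: fpsP => n.
  rewrite fpsDE !lin_extE -big_split; apply: eq_bigr => i _.
  by rewrite fpsDE (lin_add (lp _)).
rewrite lin_extE fps_scaleE.
transitivity (\sum_(i < n.+1) \sum_(j < i.+1)
    a j *: p (n - i)%N (X (i - j)%N)).
  apply: eq_bigr => i _; rewrite fps_scaleE (lin_sum (lp _)).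
  by apply: eq_bigr => j _; rewrite (lin_scale (lp _)).
rewrite (triangle_exchange (fun j k l => a j *: p l (X k))).
by apply: eq_bigr => j _; rewrite lin_extE scaler_sumr.
Qed.

Lemma bilin_ext_linearr (m : fps (V -> V -> V)) :
  (forall i x, linear (m i x)) ->
  forall X, linear (bilin_ext m X : fps V -> fps V).
Proof.
move=> lm X; pose L i := lin_ext (fun k => m k (X i)).
have lL i : linear (L i : fps V -> fps V) by apply: lin_ext_linear => k.
apply: linear_addZ => [Y Z|a Y]; apply: fpsP => n.
  rewrite fpsDE !bilin_extE -big_split; apply: eq_bigr => i _.
  by rewrite -[LHS]/(L i _ _) (lin_add (lL i)) fpsDE.
rewrite bilin_extE fps_scaleE.
transitivity (\sum_(i < n.+1) \sum_(j < (n - i).+1)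
    a j *: L i Y (n - i - j)%N).
  by apply: eq_bigr => i _; rewrite -[LHS]/(L i _ _) (lin_scale (lL i)).
rewrite -(triangle_exchange (fun i j k => a j *: L i Y k)).
transitivity (\sum_(i < n.+1) \sum_(j < i.+1)
    a j *: L (i - j)%N Y (n - i)%N).
  apply: eq_bigr => i _; rewrite (reindex_inj rev_ord_inj) /=.
  by apply: eq_bigr => j _; rewrite subSS subKn // -ltnS.
rewrite (triangle_exchange (fun j i k => a j *: L i Y k)).
by apply: eq_bigr => j _; rewrite bilin_extE scaler_sumr.
Qed.

End LinearExtensions.

(** * The given pair extended to power series *)

Section CharTwo.
Variables (R : comNzRingType) (V : lmodType R).
Hypothesis charR2 : 2%N \in [pchar R].

Lemma addvv (x : V) : x + x = 0.
Proof. by rewrite -mulr2n -scaler_nat pcharf0 // scale0r. Qed.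

Lemma addv_eq0 (x y : V) : x + y = 0 <-> x = y.
Proof.
by split=> [xy0|->]; rewrite ?addvv // -[x]addr0 -(addvv y) addrA xy0 add0r.
Qed.

Lemma alternatingC (b : V -> V -> V) x y :
  alternating_bilinear b -> b x y = b y x.
Proof.
move=> [[bl br] bb]; have := bb (x + y).
rewrite (lin_add (bl _)) !(lin_add (br _)) !bb.
by rewrite add0r addr0 addv_eq0.
Qed.

Lemma fps_pchar2 : 2%N \in [pchar (fps R)].
Proof.
rewrite inE /=; apply/eqP/fpsP => n.
rewrite mulr2n fpsDE; have r2 (r : R) : r + r = 0 by exact: addrr_pchar2.
by case: n.
Qed.

End CharTwo.

(** [brx], [sqx] and [Dx] denote the operations of the given pair extended to
    g[[t]]. *)
Section ConstantExtension.
Variables (F : fieldType) (g : lmodType F) (br : g -> g -> g) (sq D : g -> g).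
Hypotheses (charF2 : 2%N \in [pchar F]) (pairD : reslieder br sq D).

Let rl := reslieder_restricted pairD.
Let lie := restricted_lie_bracket rl.
Let brl y : linear (br^~ y) := (lie_alternating lie).1.1 y.
Let brr x : linear (br x) := (lie_alternating lie).1.2 x.
Let lD : linear D := reslieder_linear pairD.

Local Notation brx := (bilin_ext (fpsC br) : fps g -> fps g -> fps g).
Local Notation sqx := (sq_ext (fpsC br) (fpsC sq) : fps g -> fps g).
Local Notation Dx := (lin_ext (fpsC D) : fps g -> fps g).

Let addx2 (X : fps g) : X + X = 0.
Proof. by apply: addvv; apply: fps_pchar2. Qed.

Let bracketC x y : br x y = br y x.
Proof. by apply: alternatingC => //; apply: lie_alternating. Qed.

Lemma bracketxC X Y : brx X Y = brx Y X.
Proof.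
rewrite bilin_ext_flip; congr (bilin_ext _ Y X).
apply: fpsP => -[|k] //; apply/funext => x; apply/funext => y.
exact: bracketC.
Qed.

Lemma bracketx_linearr X : linear (brx X).
Proof.
apply: bilin_ext_linearr => -[|i] x //.
by apply: linear_addZ => *; rewrite ?addr0 ?scaler0.
Qed.

Lemma bracketx_linearl Y : linear (brx^~ Y).
Proof. by move=> a X Z; rewrite !(bracketxC _ Y) (bracketx_linearr Y). Qed.

Let brxDl X X' Y : brx (X + X') Y = brx X Y + brx X' Y.
Proof. exact: (lin_add (bracketx_linearl Y)). Qed.
Let brxDr X Y Y' : brx X (Y + Y') = brx X Y + brx X Y'.
Proof. exact: (lin_add (bracketx_linearr X)). Qed.
Let brxZl a X Y : brx (a *: X) Y = a *: brx X Y.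
Proof. exact: (lin_scale (bracketx_linearl Y)). Qed.
Let brxZr a X Y : brx X (a *: Y) = a *: brx X Y.
Proof. exact: (lin_scale (bracketx_linearr X)). Qed.

Lemma bracketx_Cl x Y n : brx (fpsC x) Y n = br x (Y n).
Proof.
rewrite bilin_ext_fpsC big_ord_recl subn0 big1 ?addr0 // => i _.
exact: (lin_0 (brl _)).
Qed.

Lemma bracketx_C x y : brx (fpsC x) (fpsC y) = fpsC (br x y).
Proof.
by apply: fpsP => -[|n]; rewrite bracketx_Cl //= (lin_0 (brr x)).
Qed.

Lemma bracketxx X : brx X X = 0.
Proof.
apply: (@additive_eq0 _ _ _ (fun X => brx X X) 1) => [Y Z|Y|x].
- rewrite brxDl !brxDr (bracketxC Z Y) addrA -(addrA (brx Y Y)).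
  by rewrite addx2 addr0.
- by rewrite brxZl brxZr scalerA.
- by rewrite bracketx_C (lie_alternating lie).2 fpsC0.
Qed.

Lemma jacobix X Y Z :
  brx X (brx Y Z) + brx Y (brx Z X) + brx Z (brx X Y) = 0.
Proof.
pose J X Y Z := brx X (brx Y Z) + brx Y (brx Z X) + brx Z (brx X Y).
have J_rot X' Y' Z' : J X' Y' Z' = J Y' Z' X' by rewrite /J [LHS](AC 3 (2*3*1)).
have J0 Y' Z' : (forall x, J (fpsC x) Y' Z' = 0) -> forall X', J X' Y' Z' = 0.
  apply: (@additive_eq0 _ _ _ (fun X => J X Y' Z') 0) => [A B|A].
    rewrite /J !(brxDl, brxDr).
    by rewrite [LHS](AC (2*2*2) ((1*3*5)*(2*4*6))).
  by rewrite /J !(brxZl, brxZr) !scalerDr expr1.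
(* J is linear in its first argument and invariant under rotation, so the three
   arguments become constant one after the other. *)
rewrite -/(J X Y Z); apply: (J0) => x; rewrite J_rot.
apply: (J0) => y; rewrite J_rot; apply: (J0) => z.
by rewrite /J !bracketx_C -!fpsCD (lie_jacobi lie) fpsC0.
Qed.

Let sq0 : sq 0 = 0.
Proof. by have := restricted_scale rl 0 0; rewrite expr0n /= !scale0r. Qed.

Lemma sqx_C x : sqx (fpsC x) = fpsC (sq x).
Proof.
rewrite sq_ext_C => [|[|k] u|[|k]] //; last exact: (lin_0 (brr u)).
by apply: fpsP => -[].
Qed.

Lemma sqxD X Y : sqx (X + Y) = sqx X + sqx Y + brx X Y.
Proof.
apply: fpsP => n; rewrite !fpsDE !sq_ext_fpsC.
pose S2 (A B : fps g) :=
  \sum_(i < n.+1) \sum_(j < n.+1 | (i < j)%N && (i + j == n)%N) br (A i) (B j).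
have ->: brx X Y n =
    \sum_(i < n.+1 | (i.*2 == n)%N) br (X i) (Y i) + (S2 X Y + S2 Y X).
  (* the terms i = j, i < j and i > j of the double sum *)
  rewrite bilin_ext_fpsC_sum.
  have split_lt (i : 'I_n.+1) :
    \sum_(j < n.+1 | (i + j == n)%N) br (X i) (Y j) =
    (if (i.*2 == n)%N then br (X i) (Y i) else 0) +
    (\sum_(j < n.+1 | (i < j)%N && (i + j == n)%N) br (X i) (Y j) +
     \sum_(j < n.+1 | (j < i)%N && (j + i == n)%N) br (Y j) (X i)).
    rewrite addrA big_mkcond (bigD1 i) //= addnn -addrA; congr (_ + _).
    rewrite (bigID (fun j : 'I_n.+1 => (i < j)%N)) /= -!big_mkcondr /=.
    congr (_ + _); apply: eq_big => [j|j _] //.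
    - by rewrite -(inj_eq val_inj) /=; case: ltngtP; rewrite ?andbT ?andbF.
    - rewrite -(inj_eq val_inj) /= addnC.
      by case: ltngtP; rewrite ?andbT ?andbF.
  under eq_bigr do rewrite split_lt.
  rewrite !big_split -big_mkcond /=; congr (_ + (_ + _)).
  rewrite /S2 (exchange_big_dep xpredT) //=.
under eq_bigr do rewrite (restricted_add rl).
rewrite !big_split /= -!addrA; congr (_ + _).
rewrite [RHS](AC (1*(1*(1*(1*2)))) (2*(4*((1*5)*(6*3))))) /=.
congr (_ + (_ + _)); rewrite -!big_split; apply: eq_bigr => i _ /=.
rewrite -!big_split; apply: eq_bigr => j _ /=.
by rewrite !fpsDE (lin_add (brl _)) !(lin_add (brr _)).
Qed.

(** Homogeneity of the squaring is only needed for constants and for t. *)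
Lemma sqxZC a X : sqx (fpsC a *: X) = fpsC a ^+ 2 *: sqx X.
Proof.
apply: fpsP => n; rewrite fpsC_sqr fpsC_scaleE !sq_ext_fpsC scalerDr.
rewrite !scaler_sumr; congr (_ + _); apply: eq_bigr => i _.
  by rewrite fpsC_scaleE (restricted_scale rl).
rewrite scaler_sumr; apply: eq_bigr => j _; rewrite !fpsC_scaleE.
by rewrite (lin_scale (brl _)) (lin_scale (brr _)) scalerA.
Qed.

Lemma sqxT X : sqx (fpsT F *: X) = fpsT F ^+ 2 *: sqx X.
Proof.
have br0 x : br 0 x = 0 := lin_0 (brl x).
have brx0 x : br x 0 = 0 := lin_0 (brr x).
rewrite expr2 -scalerA; set TX : fps g := fpsT F *: X.
have TX0 : TX 0%N = 0 := fpsT_scale0 X.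
have TXS k : TX k.+1 = X k := fpsT_scaleS X k.
apply: fpsP => -[|[|n]]; rewrite ?(fpsT_scaleS, fpsT_scale0) sq_ext_fpsC.
- rewrite big_mkcond big_ord1 /= TX0 sq0 add0r big_ord1.
  by rewrite big_mkcond big_ord1.
- rewrite big1 => [|[[|[]]]] //; rewrite add0r big1 // => -[[|[|//]]] ilt _.
    by rewrite big1 // => j _; rewrite TX0 br0.
  by rewrite big1 // => -[[|[|//]]].
rewrite sq_ext_fpsC; congr (_ + _).
  rewrite big_mkcond big_ord_recl /= add0r big_ord_recr /=.
  rewrite !ifF; last by apply/negbTE; rewrite /bump /=; lia.
  rewrite addr0 [RHS]big_mkcond; apply: eq_bigr => i _.
  by rewrite TXS.
rewrite big_ord_recl big1 ?add0r => [|j _]; last by rewrite TX0 br0.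
rewrite big_ord_recr /= [X in _ + X]big1 ?addr0 => [|j]; last first.
  by rewrite /bump /= => /andP[lt_j /eqP]; lia.
apply: eq_bigr => i _; rewrite big_mkcond big_ord_recl ltn0 /= add0r.
rewrite big_ord_recr /= [X in _ + X]ifF; last first.
  by apply/negbTE; rewrite /bump /=; lia.
rewrite addr0 [RHS]big_mkcond; apply: eq_bigr => j _.
by rewrite !TXS /bump /= !add1n ltnS addSnnS !addnS !eqSS.
Qed.

Lemma adx_sq X Y : brx (sqx X) Y = brx X (brx X Y).
Proof.
have addx_eq0 := @addv_eq0 _ (fps g) (fps_pchar2 charF2).
apply/addx_eq0.
apply: (@additive_eq0 _ _ _ (fun X => brx (sqx X) Y + brx X (brx X Y)) 1).
- move=> A B; have jac : brx (brx A B) Y = brx A (brx B Y) + brx B (brx A Y).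
    apply/addx_eq0; rewrite addrC (bracketxC (brx A B)) (bracketxC A Y).
    exact: jacobix.
  rewrite sqxD; move: (sqx A) (sqx B) => SA SB; rewrite !(brxDl, brxDr) jac.
  rewrite [LHS](AC ((2*2)*(2*2)) (((1*5)*(2*8))*((3*6)*(4*7)))) /=.
  by rewrite !addx2 !addr0.
- by move=> A; rewrite sqxT !(brxZl, brxZr) scalerDr scalerA.
- move=> x; apply/addx_eq0/fpsP => n.
  by rewrite sqx_C !bracketx_Cl (restricted_ad rl).
Qed.


Lemma Dx_linear : linear Dx.
Proof.
apply: linear_addZ => [X Y|a X]; apply: fpsP => n.
  by rewrite fpsDE !lin_ext_fpsC (lin_add lD).
rewrite lin_ext_fpsC !fps_scaleE (lin_sum lD); apply: eq_bigr => i _.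
by rewrite lin_ext_fpsC (lin_scale lD).
Qed.

Lemma Dx_der X Y : Dx (brx X Y) = brx (Dx X) Y + brx X (Dx Y).
Proof.
apply: fpsP => n; rewrite fpsDE lin_ext_fpsC !bilin_ext_fpsC (lin_sum lD).
rewrite -big_split; apply: eq_bigr => i _.
by rewrite (reslieder_der pairD) !lin_ext_fpsC.
Qed.

Lemma Dx_sq X : Dx (sqx X) = brx X (Dx X).
Proof.
have addx_eq0 := @addv_eq0 _ (fps g) (fps_pchar2 charF2).
have DD := lin_add Dx_linear; have DZ := lin_scale Dx_linear.
apply/addx_eq0.
apply: (@additive_eq0 _ _ _ (fun X => Dx (sqx X) + brx X (Dx X)) 1).
- move=> A B; rewrite sqxD; move: (sqx A) (sqx B) => SA SB.
  rewrite !DD Dx_der (bracketxC (Dx A) B) !(brxDl, brxDr).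
  rewrite [LHS](AC ((2*2)*(2*2)) (((1*5)*(2*8))*((3*7)*(4*6)))) /=.
  by rewrite !addx2 !addr0.
- by move=> A; rewrite sqxT !DZ !(brxZl, brxZr) scalerDr scalerA.
- move=> x; apply/addx_eq0/fpsP => n.
  rewrite sqx_C bracketx_Cl !lin_ext_fpsC.
  case: n => [|n] /=; first exact: (reslieder_sq pairD).
  by rewrite (lin_0 lD) (lin_0 (brr x)).
Qed.

Lemma bracketx_small N X Y : fps_small N Y -> fps_small N (brx X Y).
Proof.
move=> sY m ltmN; rewrite bilin_ext_fpsC big1 // => i _.
rewrite sY ?(lin_0 (brr _)) //; apply: leq_ltn_trans ltmN; exact: leq_subr.
Qed.

Lemma bracketx_lead N X Y : fps_small N Y -> brx X Y N = br (X 0%N) (Y N).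
Proof.
move=> sY; rewrite bilin_ext_fpsC big_ord_recl subn0 big1 ?addr0 // => i _.
rewrite sY ?(lin_0 (brr _)) //=; have := ltn_ord i; rewrite /bump /=; lia.
Qed.

Lemma sqx_small N X : (0 < N)%N -> fps_small N X -> fps_small N.+1 (sqx X).
Proof.
move=> N0 sX m ltmN; rewrite sq_ext_fpsC !big1 ?addr0 // => i.
  move=> _; rewrite big1 // => j /andP[ltij /eqP ijm].
  by rewrite sX ?(lin_0 (brl _)) //; lia.
by move=> /eqP im; rewrite sX ?sq0 //; lia.
Qed.

End ConstantExtension.

(** * Successive approximation *)

(** A formal series can be built one coefficient at a time. The predicate P N
    is meant to depend on the coefficients up to N only. *)
Lemma successive_approximation (T : Type) (P : nat -> fps T -> Prop)
    (X0 : fps T) : P 0%N X0 ->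
  (forall N X, P N X ->
     exists Y, (forall i, (i <= N)%N -> Y i = X i) /\ P N.+1 Y) ->
  exists X : fps T, forall N,
    exists Y, (forall i, (i <= N)%N -> X i = Y i) /\ P N Y.
Proof.
move=> P0 PS.
have next (NX : nat * fps T) : exists Y, P NX.1 NX.2 ->
    (forall i, (i <= NX.1)%N -> Y i = NX.2 i) /\ P NX.1.+1 Y.
  have [/PS[Y PY]|nP] := pselect (P NX.1 NX.2); first by exists Y.
  by exists NX.2.
have [f fP] := choice next.
pose A := fix A N := if N is N'.+1 then f (N', A N') else X0.
have PA N : P N (A N) by elim: N => // N /(fP (N, A N)) [].
have A_stable N i : (i <= N)%N -> A N i = A i i.
  elim: N => [|N IH]; first by rewrite leqn0 => /eqP ->.
  rewrite leq_eqVlt ltnS => /orP[/eqP -> //|leiN].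
  by rewrite -IH //; have [AS _] := fP (N, A N) (PA N); apply: AS.
by exists (fun n => A n n) => N; exists (A N); split=> // i /A_stable ->.
Qed.

Section Isomorphism.
Variables (R : comNzRingType) (V : lmodType R) (p : fps (V -> V)).
Hypotheses (lp : forall i, linear (p i)) (p0 : p 0%N = id).

Lemma lin_ext_lead N (X : fps V) : fps_small N X -> lin_ext p X N = X N.
Proof.
move=> sX; rewrite lin_extE big_ord_recr subnn p0 big1 => [|i _].
  exact: add0r.
by rewrite sX ?(lin_0 (lp _)) //=.
Qed.

Lemma lin_ext_injective : injective (lin_ext p : fps V -> fps V).
Proof.
move=> X Y pXY; apply/eqP; rewrite -subr_eq0; apply/eqP.
have pZ0 : lin_ext p (X - Y) = 0.
  have lP := lin_ext_linear lp.
  by rewrite (lin_add lP) -scaleN1r (lin_scale lP) scaleN1r pXY subrr.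
apply: fps_small_eq0; elim=> [m //|N sZ m].
rewrite ltnS leq_eqVlt => /orP[/eqP ->|]; last exact: sZ.
by rewrite -(lin_ext_lead sZ) pZ0.
Qed.

Lemma lin_ext_bijective : bijective (lin_ext p : fps V -> fps V).
Proof.
have lP := lin_ext_linear lp.
have surj (Y : fps V) : exists X, lin_ext p X = Y.
  pose P N X := forall m, (m <= N)%N -> lin_ext p X m = Y m.
  have P0 : P 0%N Y.
    by move=> m; rewrite leqn0 => /eqP ->; rewrite lin_ext_lead.
  have PS N X : P N X ->
      exists X', (forall i, (i <= N)%N -> X' i = X i) /\ P N.+1 X'.
    (* correct the first wrong coefficient by the defect itself *)
    move=> PX; pose Z : fps V :=
      fun k => if k == N.+1 then Y k - lin_ext p X k else 0.
    have sZ : fps_small N.+1 Z by move=> m ltm; rewrite /Z ltn_eqF.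
    exists (X + Z); split=> [i leiN|m]; first by rewrite fpsDE sZ ?addr0.
    rewrite (lin_add lP) fpsDE leq_eqVlt => /orP[/eqP ->|ltm].
      by rewrite (lin_ext_lead sZ) /Z eqxx addrC subrK.
    rewrite PX // lin_extE big1 ?addr0 // => i _.
    rewrite sZ ?(lin_0 (lp _)) //; exact: leq_trans (ltn_ord i) ltm.
  have [X XP] := successive_approximation P0 PS.
  exists X; apply: fpsP => n; have [X' [XX' PX']] := XP n.
  by rewrite -PX' //; apply: lin_ext_local.
have [q qK] := choice surj.
by exists q => // X; apply: lin_ext_injective; rewrite qK.
Qed.

End Isomorphism.

(** * The obstruction cocycle *)

(** [mux], [sigx] and [Dtx] denote the operations of the deformed pair on g[[t]],
    and [px] the extension of p. *)
Section Obstruction.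
Variables (F : fieldType) (g : lmodType F) (br : g -> g -> g) (sq D : g -> g).
Hypotheses (charF2 : 2%N \in [pchar F]) (pairD : reslieder br sq D).
Variables (mu : fps (g -> g -> g)) (sigma Dt : fps (g -> g)).
Hypothesis defD : formal_deformation br sq D mu sigma Dt.
(** The candidate isomorphism; it is not required to be a morphism. *)
Variable p : fps (g -> g).
Hypotheses (lp : forall i, linear (p i)) (p0 : p 0%N = id).

Local Notation brx := (bilin_ext (fpsC br) : fps g -> fps g -> fps g).
Local Notation sqx := (sq_ext (fpsC br) (fpsC sq) : fps g -> fps g).
Local Notation Dx := (lin_ext (fpsC D) : fps g -> fps g).
Local Notation mux := (bilin_ext mu : fps g -> fps g -> fps g).
Local Notation sigx := (sq_ext mu sigma : fps g -> fps g).
Local Notation Dtx := (lin_ext Dt : fps g -> fps g).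
Local Notation px := (lin_ext p : fps g -> fps g).

Let rl := reslieder_restricted (deformation_reslieder defD).
Let lie := restricted_lie_bracket rl.
Let muxl Y : linear (mux^~ Y) := (lie_alternating lie).1.1 Y.
Let muxr X : linear (mux X) := (lie_alternating lie).1.2 X.
Let lDt : linear Dtx := reslieder_linear (deformation_reslieder defD).
Let lpx : linear px := lin_ext_linear lp.
Let brxl := bracketx_linearl charF2 pairD.
Let brxr := bracketx_linearr pairD.
Let lDx := Dx_linear pairD.
Let mul i y : linear ((mu i)^~ y) := (deformation_mu defD i).1.1 y.
Let mur i x : linear (mu i x) := (deformation_mu defD i).1.2 x.

Let addx2 (X : fps g) : X + X = 0.
Proof. by apply: addvv; apply: fps_pchar2. Qed.

Lemma mux_C x y : mux (fpsC x) (fpsC y) = fun k => mu k x y.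
Proof.
by apply: bilin_ext_C => k u; rewrite ?(lin_0 (mur _ _)) ?(lin_0 (mul _ _)).
Qed.

Lemma Dtx_C x : Dtx (fpsC x) = fun k => Dt k x.
Proof. by apply: lin_ext_C => k; apply: lin_0 (deformation_D defD k). Qed.

Lemma px_C x : px (fpsC x) = fun k => p k x.
Proof. by apply: lin_ext_C => k; apply: lin_0 (lp k). Qed.

(** By homogeneity sigma_t maps the zero series to zero, and the coefficient of
    t^n in this equation gives sigma_n 0 once the lower ones vanish. *)
Lemma sigma_0 k : sigma k 0 = 0.
Proof.
have sx0 : sigx 0 = 0.
  by have := restricted_scale rl 0 0; rewrite expr0n /= !scale0r.
elim/ltn_ind: k => n IH; move/(congr1 (@^~ n)): sx0.
rewrite /sq_ext [X in _ + X]big1 => [|i _]; last first.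
  by rewrite big1 // => j _; rewrite big1 // => k _; apply: lin_0 (mur k _).
rewrite addr0 big_ord_recl (sum_addn_eq 0 n (fun k => sigma k 0)) /= subn0.
rewrite big1 ?addr0 // => i _; rewrite big1 // => k /eqP ikn.
by apply: IH; move: ikn; rewrite /bump /=; lia.
Qed.

Lemma sigx_C x : sigx (fpsC x) = fun k => sigma k x.
Proof.
by apply: sq_ext_C sigma_0 => k u; apply: lin_0 (mur k u).
Qed.

(** The defects of p as a morphism from the deformed pair to the given one, for
    the bracket, the squaring and the derivation: sums of the two sides of the
    morphism equations, that is, differences in characteristic 2. *)
Definition defect_br (X Y : fps g) : fps g := px (mux X Y) + brx (px X) (px Y).
Definition defect_sq (X : fps g) : fps g := px (sigx X) + sqx (px X).
Definition defect_D (X : fps g) : fps g := px (Dtx X) + Dx (px X).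

(** p is a morphism modulo t^N. As in the definition of a trivial deformation,
    the equations are required on constant series only. *)
Definition morphism_mod (N : nat) : Prop :=
  [/\ forall x y, fps_small N (defect_br (fpsC x) (fpsC y)),
      forall x, fps_small N (defect_sq (fpsC x))
    & forall x, fps_small N (defect_D (fpsC x))].

Let pxD := lin_add lpx.
Let pxZ := lin_scale lpx.

Lemma defect_br_linearl Y : linear (defect_br^~ Y).
Proof.
apply: linear_addZ => [X X'|a X]; rewrite /defect_br.
  by rewrite (lin_add (muxl Y)) !pxD (lin_add (brxl _)) addrACA.
by rewrite (lin_scale (muxl Y)) !pxZ (lin_scale (brxl _)) scalerDr.
Qed.

Lemma defect_br_linearr X : linear (defect_br X).
Proof.
apply: linear_addZ => [Y Y'|a Y]; rewrite /defect_br.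
  by rewrite (lin_add (muxr X)) !pxD (lin_add (brxr _)) addrACA.
by rewrite (lin_scale (muxr X)) !pxZ (lin_scale (brxr _)) scalerDr.
Qed.

Lemma defect_D_linear : linear defect_D.
Proof.
apply: linear_addZ => [X Y|a X]; rewrite /defect_D.
  by rewrite (lin_add lDt) !pxD (lin_add lDx) addrACA.
by rewrite (lin_scale lDt) !pxZ (lin_scale lDx) scalerDr.
Qed.

Lemma defect_brC X Y : defect_br X Y = defect_br Y X.
Proof.
rewrite /defect_br (bracketxC charF2 pairD (px X)); congr (px _ + _).
by apply: alternatingC (lie_alternating lie); apply: fps_pchar2.
Qed.

(** The sum of p applied to one term of the Jacobi identity of the deformed pair
    and of the corresponding term for the given pair, in terms of defects. Each of
    the next four identities between defects results from applying p to an axiom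
    of the deformed pair and comparing with the same axiom of the given one. *)
Let defect_br_mux X Y Z :
  brx (px X) (defect_br Y Z) + defect_br X (mux Y Z) =
  px (mux X (mux Y Z)) + brx (px X) (brx (px Y) (px Z)).
Proof.
rewrite /defect_br (lin_add (brxr _)) addrC -!addrA; congr (_ + _).
by rewrite addrA addx2 add0r.
Qed.

Lemma defect_jacobi X Y Z :
  (brx (px X) (defect_br Y Z) + defect_br X (mux Y Z)) +
  (brx (px Y) (defect_br Z X) + defect_br Y (mux Z X)) +
  (brx (px Z) (defect_br X Y) + defect_br Z (mux X Y)) = 0.
Proof.
rewrite !defect_br_mux [LHS](AC (2*2*2) ((1*3*5)*(2*4*6))) /=.
by rewrite -!pxD (lie_jacobi lie) (lin_0 lpx) add0r (jacobix charF2 pairD).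
Qed.

Lemma defect_ad X Y :
  defect_br (sigx X) Y + brx (px Y) (defect_sq X) =
  brx (px X) (defect_br X Y) + defect_br X (mux X Y).
Proof.
rewrite defect_br_mux /defect_br /defect_sq (lin_add (brxr _)).
rewrite (bracketxC charF2 pairD (px Y)) -addrA.
rewrite (addrA (brx _ _)) addx2 add0r.
rewrite (bracketxC charF2 pairD (px Y)) (adx_sq charF2 pairD).
by rewrite (restricted_ad rl).
Qed.

Lemma defect_der X Y :
  defect_D (mux X Y) + Dx (defect_br X Y) =
  (defect_br (Dtx X) Y + brx (px Y) (defect_D X)) +
  (defect_br X (Dtx Y) + brx (px X) (defect_D Y)).
Proof.
rewrite /defect_D /defect_br (reslieder_der (deformation_reslieder defD)).
rewrite (lin_add lDx) !pxD !(lin_add (brxr _)) (Dx_der pairD).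
rewrite !(bracketxC charF2 pairD (px Y)).
rewrite [LHS](AC (3*(1*2)) (((1*5)*(2*6))*(3*4))) /= addx2 addr0.
rewrite [RHS](AC ((2*2)*(2*2)) (((1*4)*(5*8))*((2*3)*(6*7)))) /=.
by rewrite !addx2 !addr0.
Qed.

Lemma defect_D_sq X :
  defect_D (sigx X) + Dx (defect_sq X) =
  defect_br X (Dtx X) + brx (px X) (defect_D X).
Proof.
rewrite /defect_D /defect_br /defect_sq (lin_add lDx) (lin_add (brxr _)).
rewrite (Dx_sq charF2 pairD) (reslieder_sq (deformation_reslieder defD)).
rewrite -!addrA; congr (_ + _); rewrite !addrA; congr (_ + _).
by rewrite !addx2.
Qed.

Let mux0 X Y : mux X Y 0%N = br (X 0%N) (Y 0%N).
Proof.
by rewrite bilin_extE big_ord1 lin_extE big_ord1 (deformation_mu0 defD).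
Qed.

Let px0 X : px X 0%N = X 0%N.
Proof. by rewrite lin_extE big_ord1 p0. Qed.

Let Dtx0 X : Dtx X 0%N = D (X 0%N).
Proof. by rewrite lin_extE big_ord1 (deformation_D0 defD). Qed.

Let sigx0 x : sigx (fpsC x) 0%N = sq x.
Proof. by rewrite sigx_C (deformation_sigma0 defD). Qed.

(** The coefficients of t^N in the defects on constant series; the leading ones
    when p is a morphism modulo t^N. *)
Definition obstruction (N : nat) : triple g :=
  ((fun x y => defect_br (fpsC x) (fpsC y) N, fun x => defect_sq (fpsC x) N),
   fun x => defect_D (fpsC x) N).

Lemma obstruction_cochain N : C2 (obstruction N).
Proof.
split=> [|a x|x y|a x y].
- split=> [|x]; last first.
    rewrite /defect_br (lie_alternating lie).2 (lin_0 lpx) add0r.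
    by rewrite (bracketxx charF2 pairD).
  split=> [y a x x'|x a y y'] /=; rewrite fpsCD fpsCZ.
    by rewrite (defect_br_linearl _) fpsDE fpsC_scaleE.
  by rewrite (defect_br_linearr _) fpsDE fpsC_scaleE.
- rewrite -[RHS](fpsC_scaleE _ (defect_sq _)) -fpsC_sqr fpsCZ /defect_sq scalerDr.
  by rewrite (restricted_scale rl) !pxZ (sqxZC pairD).
- suff -> : defect_sq (fpsC (x + y)) =
    defect_sq (fpsC x) + defect_sq (fpsC y) + defect_br (fpsC x) (fpsC y) by [].
  rewrite fpsCD /defect_sq /defect_br (restricted_add rl) !pxD.
  by rewrite (sqxD charF2 pairD) [LHS](AC (3*3) (1*4*(2*5)*(3*6))).
- by rewrite fpsCD fpsCZ defect_D_linear fpsDE fpsC_scaleE.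
Qed.

Section Leading.
Variable N : nat.
Hypothesis pN : morphism_mod N.

Let br_lead : forall X Y, defect_br X Y N =
  defect_br (fpsC (X 0%N)) (fpsC (Y 0%N)) N.
Proof.
have [pbr _ _] := pN.
apply: bilinear_lead => //; [exact: defect_br_linearl|exact: defect_br_linearr].
Qed.

Let D_lead X : defect_D X N = defect_D (fpsC (X 0%N)) N.
Proof. have [_ _ pD] := pN; exact: (linear_lead defect_D_linear). Qed.

Let brx_lead := bracketx_lead charF2 pairD.

Lemma obstruction_cocycle : Z2 br sq D (obstruction N).
Proof.
have [pbr psq pD] := pN; split; first exact: obstruction_cochain.
have br_at x Y : fps_small N Y -> brx (px (fpsC x)) Y N = br x (Y N).
  by move=> sY; rewrite brx_lead // px0.
have mux_at x y z :
    defect_br (fpsC x) (mux (fpsC y) (fpsC z)) N =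
    defect_br (fpsC x) (fpsC (br y z)) N by rewrite br_lead mux0.
split=> [x y z|x y|x y|x] /=.
- have := congr1 (@^~ N) (defect_jacobi (fpsC x) (fpsC y) (fpsC z)).
  rewrite !fpsDE !br_at // !mux_at => jac.
  by rewrite !(defect_brC (fpsC (br _ _))); apply: jac.
- have /(congr1 (@^~ N)) := defect_ad (fpsC x) (fpsC y).
  rewrite !fpsDE !br_at // mux_at br_lead sigx0 (defect_brC (fpsC (br _ _))).
  by move/(addv_eq0 charF2) <-; rewrite [LHS](AC 4 ((2*4)*(1*3))).
- have /(congr1 (@^~ N)) := defect_der (fpsC x) (fpsC y).
  rewrite !fpsDE !br_at // D_lead lin_ext_fpsC mux0.
  rewrite (br_lead (Dtx _)) (br_lead _ (Dtx _)) !Dtx0.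
  by move/(addv_eq0 charF2) <-; rewrite [LHS](AC 6 ((1*6)*((4*3)*(5*2)))).
- have /(congr1 (@^~ N)) := defect_D_sq (fpsC x).
  rewrite !fpsDE !br_at // D_lead lin_ext_fpsC sigx0 (br_lead _ (Dtx _)) Dtx0.
  by move/(addv_eq0 charF2) <-; rewrite [LHS](AC 4 ((1*3)*(4*2))).
Qed.
End Leading.

End Obstruction.

(** * Removing the obstruction *)

Lemma fps_smallSn (V : zmodType) N (X : fps V) :
  fps_small N X -> X N = 0 -> fps_small N.+1 X.
Proof.
by move=> sX XN m; rewrite ltnS leq_eqVlt => /orP[/eqP ->|/sX].
Qed.

(** The series rho t^N. *)
Definition fps_monomial (V : zmodType) (rho : V -> V) (N : nat) : fps (V -> V) :=
  fun k => if k == N then rho else fun=> 0.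

Section Monomial.
Variables (R : comNzRingType) (V : lmodType R) (rho : V -> V) (N : nat).
Hypothesis lrho : linear rho.

Lemma monomial_linear k : linear (fps_monomial rho N k).
Proof.
rewrite /fps_monomial; case: eqP => // _ a x y.
by rewrite scaler0 addr0.
Qed.

Lemma monomial_small (X : fps V) : fps_small N (lin_ext (fps_monomial rho N) X).
Proof.
move=> m ltmN; rewrite lin_extE big1 // => i _.
by rewrite /fps_monomial ltn_eqF //; apply: leq_ltn_trans ltmN; apply: leq_subr.
Qed.

Lemma monomial_lead (X : fps V) :
  lin_ext (fps_monomial rho N) X N = rho (X 0%N).
Proof.
rewrite lin_extE big_ord_recl subn0 /= {1}/fps_monomial eqxx.
rewrite big1 ?addr0 // => i _; rewrite /fps_monomial ifF //.
by apply/negbTE; have := ltn_ord i; rewrite /bump /=; lia.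
Qed.

End Monomial.

Lemma lin_extD (R : comNzRingType) (V : lmodType R) (p q : fps (V -> V))
    (X : fps V) :
  lin_ext (fun k x => p k x + q k x) X = lin_ext p X + lin_ext q X.
Proof.
by apply: fpsP => n; rewrite fpsDE !lin_extE -big_split.
Qed.

(** When the only coset is B2 itself, a cocycle c lies in its own coset c + B2,
    which is B2. *)
Lemma H2_eq0_coboundary (F : fieldType) (g : lmodType F) (br : g -> g -> g)
    (sq D : g -> g) (c : triple g) :
  (forall x, br x 0 = 0) -> D 0 = 0 ->
  H2_eq0 br sq D -> Z2 br sq D c ->
  exists2 rho : g -> g, linear rho & theta1 br sq D rho = c.
Proof.
move=> br0 D0 H0 cZ.
have B0 : B2 br sq D 0.
  exists (fun=> 0) => [a x y|]; first by rewrite scaler0 addr0.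
  congr (_, _, _); last by apply/funext => x; rewrite D0 addr0.
    by apply/funext => x; apply/funext => y; rewrite !br0 !addr0.
  by apply/funext => x; rewrite br0 addr0.
have : H2 br sq D (fun d => exists2 b, B2 br sq D b & c + b = d) by exists c.
rewrite H0 => cB; have : B2 br sq D c by rewrite -cB; exists 0; rewrite ?addr0.
by case=> rho lrho <-; exists rho.
Qed.

Section Step.
Variables (F : fieldType) (g : lmodType F) (br : g -> g -> g) (sq D : g -> g).
Hypotheses (charF2 : 2%N \in [pchar F]) (pairD : reslieder br sq D).
Variables (mu : fps (g -> g -> g)) (sigma Dt : fps (g -> g)).
Hypothesis defD : formal_deformation br sq D mu sigma Dt.

(** Adding rho t^N to p changes the leading coefficients of the defects of p
    by theta1 rho, hence cancels them when they are equal to theta1 rho. *)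
Lemma morphism_mod_step (p : fps (g -> g)) (N : nat) (rho : g -> g) :
  (0 < N)%N -> (forall i, linear (p i)) -> p 0%N = id -> linear rho ->
  morphism_mod br sq D mu sigma Dt p N ->
  theta1 br sq D rho = obstruction br sq D mu sigma Dt p N ->
  morphism_mod br sq D mu sigma Dt
    (fun k x => p k x + fps_monomial rho N k x) N.+1.
Proof.
move=> N0 lp p0 lrho [pbr psq pD] ob.
set q := (X in morphism_mod _ _ _ _ _ _ X _).
set r := lin_ext (fps_monomial rho N) : fps g -> fps g.
have qE X : lin_ext q X = lin_ext p X + r X by exact: lin_extD.
have r_small X : fps_small N (r X) by exact: monomial_small.
have r_lead X : r X N = rho (X 0%N) by exact: monomial_lead.
have brxDl Y := lin_add (bracketx_linearl charF2 pairD Y).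
have brxDr X := lin_add (bracketx_linearr pairD X).
have brx_small := bracketx_small pairD.
have brx_lead := bracketx_lead charF2 pairD.
have p_C0 x : lin_ext p (fpsC x) 0%N = x by rewrite lin_extE big_ord1 p0.
have br0 x : br 0 x = 0.
  exact: lin_0 ((lie_alternating (restricted_lie_bracket
    (reslieder_restricted pairD))).1.1 x).
have sqv x : x + x = 0 := addvv charF2 x.
split=> [x y|x|x].
- set X : fps g := fpsC x; set Y : fps g := fpsC y.
  have -> : defect_br br mu q X Y = defect_br br mu p X Y +
      (r (bilin_ext mu X Y) + bilin_ext (fpsC br) (lin_ext p X) (r Y) +
       bilin_ext (fpsC br) (lin_ext p Y) (r X)) +
      bilin_ext (fpsC br) (r X) (r Y).
    rewrite /defect_br !qE !(brxDl, brxDr) (bracketxC charF2 pairD (r X)).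
    by rewrite [LHS](AC (2*(2*2)) ((1*3)*((2*4)*5)*6)).
  have s0 := pbr x y; have s1 := @r_small (bilin_ext mu X Y).
  have s2 := brx_small _ (lin_ext p X) _ (r_small Y).
  have s3 := brx_small _ (lin_ext p Y) _ (r_small X).
  have s4 := brx_small _ (r X) _ (r_small Y).
  apply: fps_smallSn; first by do 4!apply: fps_smallD => //.
  rewrite !fpsDE !brx_lead // !p_C0 !r_lead (r_small X) // br0.
  rewrite bilin_extE big_ord1 lin_extE big_ord1 (deformation_mu0 defD) /=.
  have -> : defect_br br mu p X Y N = (theta1 br sq D rho).1.1 x y by rewrite ob.
  by rewrite addr0 sqv.
- set X : fps g := fpsC x.
  have -> : defect_sq br sq mu sigma q X = defect_sq br sq mu sigma p X +
      (r (sq_ext mu sigma X) + bilin_ext (fpsC br) (lin_ext p X) (r X)) +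
      sq_ext (fpsC br) (fpsC sq) (r X).
    rewrite /defect_sq !qE (sqxD charF2 pairD).
    by rewrite [LHS](AC (2*3) ((1*3)*(2*5)*4)).
  have s0 := psq x; have s1 := @r_small (sq_ext mu sigma X).
  have s2 := brx_small _ (lin_ext p X) _ (r_small X).
  (* the square of rho t^N is divisible by t^(2N), hence by t^(N+1) *)
  have s3 := sqx_small charF2 pairD N0 (r_small X).
  apply: fps_smallD => //.
  apply: fps_smallSn; first by do 2!apply: fps_smallD => //.
  rewrite !fpsDE brx_lead // p_C0 !r_lead (sigx_C defD).
  rewrite (deformation_sigma0 defD) /=.
  have -> : defect_sq br sq mu sigma p X N = (theta1 br sq D rho).1.2 x.
    by rewrite ob.
  exact: sqv.
- set X : fps g := fpsC x.
  have -> : defect_D D Dt q X = defect_D D Dt p X +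
      (lin_ext (fpsC D) (r X) + r (lin_ext Dt X)).
    rewrite /defect_D !qE (lin_add (Dx_linear pairD)).
    by rewrite [LHS](AC (2*2) ((1*3)*(4*2))).
  have s0 := pD x; have s1 := @r_small (lin_ext Dt X).
  have s2 : fps_small N (lin_ext (fpsC D) (r X)).
    move=> m ltm; rewrite lin_ext_fpsC r_small //.
    exact: lin_0 (reslieder_linear pairD).
  apply: fps_smallSn; first by do 2!apply: fps_smallD => //.
  rewrite !fpsDE lin_ext_fpsC !r_lead lin_extE big_ord1 (deformation_D0 defD) /=.
  have -> : defect_D D Dt p X N = (theta1 br sq D rho).2 x by rewrite ob.
  exact: sqv.
Qed.
End Step.

Theorem theorem4p9 (F : fieldType) (charF2 : 2%N \in [pchar F])
    (g : lmodType F) (br : g -> g -> g) (sq D : g -> g)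
    (pairD : reslieder br sq D) :
  H2_eq0 br sq D -> rigid br sq D.
Proof.
move=> H0 mu sigma Dt defD.
have lD := reslieder_linear pairD.
have lie := restricted_lie_bracket (reslieder_restricted pairD).
have brr x : linear (br x) := (lie_alternating lie).1.2 x.
pose P N p := [/\ forall i, linear (p i), p 0%N = id
  & morphism_mod br sq D mu sigma Dt p N.+1].
(* the identity is a morphism modulo t *)
have P0 : P 0%N (fpsC (@id g)).
  have small1 (X : fps g) : X 0%N = 0 -> fps_small 1 X by move=> X0 [].
  split=> // [[|i] a x y //=|]; first by rewrite scaler0 addr0.
  split=> [x y|x|x]; apply: small1;
    rewrite /defect_br /defect_sq /defect_D fpsDE lin_ext_fpsC.
  - rewrite (mux_C defD) (deformation_mu0 defD) bilin_ext_fpsC big_ord1.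
    by rewrite !lin_ext_fpsC; apply: addvv charF2 _.
  - have -> : lin_ext (fpsC id) (fpsC x) = fpsC x.
      by apply: fpsP => n; rewrite lin_ext_fpsC.
    rewrite (sigx_C defD) (deformation_sigma0 defD) (sqx_C pairD).
    exact: addvv charF2 _.
  - rewrite (Dtx_C defD) (deformation_D0 defD) !lin_ext_fpsC.
    exact: addvv charF2 _.
have PS N p : P N p ->
    exists q, (forall i, (i <= N)%N -> q i = p i) /\ P N.+1 q.
  move=> [lp p0 pN].
  have [rho lrho ob] := H2_eq0_coboundary (fun x => lin_0 (brr x)) (lin_0 lD) H0
    (obstruction_cocycle charF2 pairD defD lp p0 pN).
  exists (fun k x => p k x + fps_monomial rho N.+1 k x); split=> [i leiN|].
    by apply/funext => x; rewrite /fps_monomial ltn_eqF ?addr0.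
  split; last exact: (morphism_mod_step charF2 pairD defD).
    move=> i; apply: linear_addZ => [x y|a x].
      rewrite (lin_add (lp i)) (lin_add (monomial_linear _ lrho i)).
      exact: addrACA.
    rewrite (lin_scale (lp i)) (lin_scale (monomial_linear _ lrho i)).
    by rewrite scalerDr.
  by apply/funext => x; rewrite p0 addr0.
have [p pP] := successive_approximation P0 PS.
have lp i : linear (p i) by have [q [-> // [lq _ _]]] := pP i.
have p0 : p 0%N = id by have [q [-> // [_ q0 _]]] := pP 0%N.
have pC (q : fps (g -> g)) x :
    (forall i, linear (q i)) -> lin_ext q (fpsC x) = fun k => q k x.
  by move=> lq; exact: (px_C lq).
have eq2 (x y : g) : x + y = 0 -> x = y by move/(addv_eq0 charF2).
exists p; first by split=> //; apply: lin_ext_bijective.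
split=> [x y|x|x]; apply: fpsP => n;
  have [q [pq [lq q0 [qbr qsq qD]]]] := pP n.
- have /eq2 := qbr x y n (ltnSn n).
  rewrite (mux_C defD) !pC // => eqn.
  rewrite (lin_ext_local (q := q) (Y := fun k => mu k x y)) // eqn.
  by apply: bilin_ext_local => i lein; rewrite pq.
- have /eq2 := qsq x n (ltnSn n); rewrite (sigx_C defD) !pC // => eqn.
  rewrite (lin_ext_local (q := q) (Y := fun k => sigma k x)) // eqn.
  by apply: sq_ext_local => i lein; rewrite pq.
- have /eq2 := qD x n (ltnSn n); rewrite (Dtx_C defD) !pC // => eqn.
  rewrite (lin_ext_local (q := q) (Y := fun k => Dt k x)) // eqn.
  by apply: lin_ext_local => // i lein; rewrite pq.
Qed.
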